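(* Let a complex Banach space $X$, with norm $\|\cdot\|_X$, be a linear subspace of $L^1(\mathbb{T})$ such that $f(\cdot+a)\in X$ whenever $f\in X$ and $a\in\mathbb{T}$. Then the norm $\|\cdot\|_{X}$ is equivalent to a certain norm $\|\cdot\|$ on $X$ satisfying the three conditions ($H_1$) $\|f\|_{L^1(\mathbb{T})}\leq\|f\|$ whenever $f\in X$; ($H_2$) $f(\cdot+a)\in X$ and $\|f(\cdot+a)\|=\|f\|$ whenever $f\in X$ and $a\in\mathbb{T}$; ($H_3$) $\|f(\cdot+b)-f(\cdot+a)\|\to 0$ as $b\to a$ whenever $f\in X$ and $a\in\mathbb{T}$ if and only if $\|\cdot\|_{X}$ satisfies the following two conditions: ($H_1^*$) there exists a number $c>0$ such that $\|f\|_{L^1(\mathbb{T})}\leq c\,\|f\|_{X}$ for every $f\in X$; ($H_3^*$) $\|f(\cdot+a)-f(\cdot)\|_{X}\to0$ as $a\to0$ for every $f\in X$.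
   Context: $\mathbb{T}$ is the additive quotient group $\mathbb{R}/2\pi\mathbb{Z}$; functions on $\mathbb{T}$ are identified with $2\pi$-periodic functions. $L^1(\mathbb{T})$ is the complex Banach space of all complex-valued functions on $\mathbb{T}$ integrable with respect to Lebesgue measure, with norm $\|f\|_{L^1(\mathbb{T})}:=\frac{1}{2\pi}\int_{-\pi}^{\pi}|f(s)|\,ds$. *)

(* Defs.v *)
From HB Require Import structures.
From mathcomp Require Import all_boot all_order all_algebra.
From mathcomp Require Import generic_quotient ring_quotient.
From mathcomp Require Import all_classical all_reals all_analysis.
From mathcomp Require Import complex measurable_realfun.
From mathcomp Require Import lra ring.
Set Implicit Arguments.
Unset Strict Implicit.
Unset Printing Implicit Defensive.
Import Order.TTheory GRing.Theory Num.Theory.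
Import numFieldNormedType.Exports.
Local Open Scope classical_set_scope.
Local Open Scope ring_scope.
Local Open Scope complex_scope.

Section shift.
Context {R : realType}.
Notation mu := (@lebesgue_measure R).
Implicit Types (a : R) (A : set (measurableTypeR R)) (g : R -> R).

Let sh a (x : measurableTypeR R) : measurableTypeR R := x + a.

Lemma measurable_sh a : measurable_fun setT (sh a).
Proof. by apply: measurable_realfun.measurable_funD. Qed.

Lemma lebesgue_measure_sh a A : measurable A -> pushforward mu (sh a) A = mu A.
Proof.
move=> mA; apply/esym.
pose nu := measure_function_pushforward__canonical__measure_function_Measure
  mu (measurable_sh a).
apply: (@lebesgue_measure_unique R nu) mA => _ [[x y] _ <-] /=.
rewrite /nu /= /pushforward.
have -> : sh a @^-1` `]x, y] = `](x - a), (y - a)]%classic :> set R.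
  by apply/seteqP; split => z /=; rewrite /sh !in_itv/= => /andP[] ? ?;
    apply/andP; split; lra.
rewrite !lebesgue_measure_itv/= !lte_fin ltrD2r; case: ifP => // _.
by rewrite -!EFinB; congr EFin; ring.
Qed.

Lemma ae_shift a (P : R -> Prop) :
  {ae mu, forall x, P x} -> {ae mu, forall x, P (x + a)}.
Proof.
move=> [N [mN N0 PN]]; exists (sh a @^-1` N); split.
- by rewrite -[X in measurable X]setTI; exact: measurable_sh.
- by rewrite -[LHS]/(pushforward mu (sh a) N) lebesgue_measure_sh.
- by move=> x /= Px; exact: (PN (x + a)).
Qed.

Lemma integrable_shift a (D : set (measurableTypeR R)) g : measurable D ->
  measurable_fun setT g -> mu.-integrable D (EFin \o g) ->
  mu.-integrable [set x | D (x + a)] (fun x => (g (x + a))%:E).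
Proof.
move=> mD mg gi.
have mE : measurable [set x | D (x + a)].
  by rewrite -[X in measurable X]setTI; exact: measurable_sh.
have mga : measurable_fun setT (fun x : R => g (x + a)).
  exact: (measurableT_comp mg (measurable_sh a)).
have DE : sh (- a) @^-1` [set x | D (x + a)] = D.
  by apply/seteqP; split => x /=; rewrite /sh -addrA addNr addr0.
have /integrableP[_] : (pushforward mu (sh (- a))).-integrable
    [set x | D (x + a)] (fun x => (g (x + a))%:E).
  apply: integrable_pushforward => //; first exact: measurable_sh.
  - exact/measurable_EFinP.
  - rewrite DE (_ : _ \o _ = EFin \o g)//.
    by apply/funext => x /=; rewrite /sh -addrA addNr addr0.
move=> H; apply/integrableP; split.
  by apply/measurable_EFinP; exact: measurable_funTS.
rewrite (_ : integral _ _ _ = integral (pushforward mu (sh (- a)))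
  [set x | D (x + a)] (fun x => `|(g (x + a))%:E|%E))//.
pose nu := measure_function_pushforward__canonical__measure_function_Measure
  mu (measurable_sh (- a)).
apply: (eq_measure_integral nu) => A mA _ /=.
by rewrite /nu/= lebesgue_measure_sh.
Qed.

Lemma integrableU (D E : set (measurableTypeR R)) g : measurable D -> measurable E ->
  measurable_fun setT g ->
  mu.-integrable D (EFin \o g) -> mu.-integrable E (EFin \o g) ->
  mu.-integrable (D `|` E) (EFin \o g).
Proof.
move=> mD mE mg gD gE.
have {}gD := (integrable_mkcond _ mD).1 gD.
have {}gE := (integrable_mkcond _ mE).1 gE.
have mDE := measurableU _ _ mD mE.
apply: (integrable_mkcond _ mDE).2.
have /= := integrableD measurableT (integrable_abse gD) (integrable_abse gE).
apply: le_integrable => //.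
  apply/(measurable_restrictT _ mDE); apply/measurable_EFinP.
  exact: measurable_funTS.
move=> x _; rewrite /patch /=.
case: ifPn => [|_]; last by rewrite [X in (X <= _)%E]abse0 abse_ge0.
rewrite in_setU => /orP[] ->.
- rewrite [leRHS]gee0_abs ?adde_ge0// ?abse_ge0//; apply: leeDl; exact: abse_ge0.
- rewrite [leRHS]gee0_abs ?adde_ge0// ?abse_ge0//; apply: leeDr; exact: abse_ge0.
Qed.

Lemma periodic_int g (k : int) : (forall x, g (x + 2 * pi) = g x) ->
  forall x, g (x + 2 * pi * k%:~R) = g x.
Proof.
move=> gp x.
have H n : forall x, g (x + 2 * pi * n%:R) = g x.
  elim: n => [|n IH] y; first by rewrite mulr0 addr0.
  by rewrite -[n.+1%:R]natr1 mulrDr mulr1 addrA gp IH.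
case: k => n; first exact: H.
by rewrite -(H n.+1) NegzE mulrNz -mulrN1z; congr g; rewrite pmulrn; ring.
Qed.

Lemma integrable_periodic_shift a g : (forall x, g (x + 2 * pi) = g x) ->
  measurable_fun setT g -> mu.-integrable `[- pi, pi] (EFin \o g) ->
  mu.-integrable `[- pi, pi] (fun x => (g (x + a))%:E).
Proof.
move=> gp mg gi.
have pi0 : 0 < pi :> R := pi_gt0 R.
pose J (k : int) : set (measurableTypeR R) := [set x | `[- pi, pi]%classic (x + (a + 2 * pi * k%:~R))].
have mJ k : measurable (J k).
  have := measurable_sh (a + 2 * pi * k%:~R) measurableT
    (measurable_itv `[- pi, pi]).
  by rewrite setTI.
have mga : measurable_fun setT (fun x : R => g (x + a)).
  exact: (measurableT_comp mg (measurable_sh a)).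
have Jk k : mu.-integrable (J k) (EFin \o (fun x => g (x + a))).
  have := @integrable_shift (a + 2 * pi * k%:~R) _ _ (measurable_itv _) mg gi.
  by apply: eq_integrable; [exact: mJ|move=> x _ /=; rewrite addrA periodic_int].
pose k := Num.floor (a / (2 * pi)).
have := integrableU (mJ _) (mJ _) mga (Jk (- k)) (Jk (- k - 1)).
apply: integrableS => //; first exact: measurableU.
have /andP[] := floor_itv (a / (2 * pi)); rewrite -/k.
rewrite ler_pdivlMr ?mulr_gt0// ltr_pdivrMr ?mulr_gt0// intrD mulr1z => h1 h2.
move=> x /=; rewrite in_itv /= => /andP[x1 x2].
rewrite /J /= !in_itv/= intrB !mulrNz mulrBr mulrN mulr1 -!(mulrC k%:~R).
case: (leP (x + (a - k%:~R * (2 * pi))) pi) => h; [left|right]; apply/andP; split=> //; lra.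
Qed.

End shift.

Section L1T.
Context {R : realType}.
Notation mu := (@lebesgue_measure R).

(* Functions on R/2piZ are represented by 2pi-periodic functions on R;
   integrability of a complex function is that of its real and imaginary
   parts. *)
Definition L1T_fun : {pred R -> R[i]} := [pred f : R -> R[i] | `[<
  [/\ forall x, f (x + 2 * pi) = f x,
      measurable_fun setT (fun x => complex.Re (f x)),
      measurable_fun setT (fun x => complex.Im (f x)),
      mu.-integrable `[- pi, pi] (fun x => (complex.Re (f x))%:E) &
      mu.-integrable `[- pi, pi] (fun x => (complex.Im (f x))%:E)] >] ].

Let mpi : measurable (`[- pi, pi]%classic : set (measurableTypeR R)).
Proof. exact: measurable_itv. Qed.

Lemma L1T_fun_submod_closed : submod_closed L1T_fun.
Proof.
split=> [|c f g /asboolP[pf mrf mif irf iif] /asboolP[pg mrg mig irg iig]].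
  apply/asboolP; split => //=; try exact: measurable_cst.
  - exact: (integrable0 mu).
  - exact: (integrable0 mu).
apply/asboolP; set h := (_ + _).
have hE x : h x = c * f x + g x by [].
have reE x : complex.Re (h x) = complex.Re c * complex.Re (f x)
    - complex.Im c * complex.Im (f x) + complex.Re (g x).
  by rewrite hE; case: (c) (f x) (g x) => [? ?] [? ?] [? ?].
have imE x : complex.Im (h x) = complex.Re c * complex.Im (f x)
    + complex.Im c * complex.Re (f x) + complex.Im (g x).
  by rewrite hE; case: (c) (f x) (g x) => [? ?] [? ?] [? ?].
split.
- by move=> x; rewrite !hE pf pg.
- rewrite (funext reE).
  apply: measurable_funD => //; apply: measurable_funB => //;
    exact: measurable_funM.
- rewrite (funext imE).
  apply: measurable_funD => //; apply: measurable_funD => //;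
    exact: measurable_funM.
- rewrite (_ : (fun x => _) = (fun x => (complex.Re c)%:E * (complex.Re (f x))%:E
    - (complex.Im c)%:E * (complex.Im (f x))%:E + (complex.Re (g x))%:E)%E);
    last by apply/funext => x; rewrite reE.
  apply: integrableD => //; apply: integrableB => //; exact: integrableZl.
- rewrite (_ : (fun x => _) = (fun x => (complex.Re c)%:E * (complex.Im (f x))%:E
    + (complex.Im c)%:E * (complex.Re (f x))%:E + (complex.Im (g x))%:E)%E);
    last by apply/funext => x; rewrite imE.
  apply: integrableD => //; apply: integrableD => //; exact: integrableZl.
Qed.

HB.instance Definition _ :=
  GRing.isSubmodClosed.Build _ _ L1T_fun L1T_fun_submod_closed.

End L1T.

Section calL1.
Variable R : realType.
Notation mu := (@lebesgue_measure R).

Let FF := ae_filter_ringOfSetsType mu.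

Record calL1T := CalL1T {
  calL1T_val :> R -> R[i];
  calL1T_valP : calL1T_val \in L1T_fun }.

HB.instance Definition _ := [isSub for calL1T_val].
HB.instance Definition _ := [Choice of calL1T by <:].
HB.instance Definition _ := [SubChoice_isSubLmodule of calL1T by <:].

(* For 2pi-periodic f, vanishing almost everywhere on R amounts to vanishing
   almost everywhere on a period. *)
Definition null_L1T : {pred calL1T} :=
  [pred f : calL1T | `[< {ae mu, forall x, f x = 0} >] ].

Lemma null_L1T_submod_closed : submod_closed null_L1T.
Proof.
split=> [|c f g /asboolP f0 /asboolP g0]; apply/asboolP.
  exact: aeW.
apply: (@filterS2 _ _ FF _ _ _ _ f0 g0) => x /= fx gx.
rewrite (_ : _ x = c * f x + g x)// fx gx mulr0 addr0 //.
Qed.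

HB.instance Definition _ :=
  GRing.isSubmodClosed.Build _ _ null_L1T null_L1T_submod_closed.

Definition L1T : Type := Quotient.quot null_L1T.
HB.instance Definition _ := Choice.on L1T.
HB.instance Definition _ := EqQuotient.on L1T.
HB.instance Definition _ := GRing.Zmodule.on L1T.
HB.instance Definition _ := ZmodQuotient.on L1T.

Local Open Scope quotient_scope.

Lemma L1T_eqP (f g : calL1T) :
  reflect {ae mu, forall x, f x = g x} (f == g %[mod L1T]).
Proof.
rewrite -Quotient.idealrBE; have fgE x : (f - g) x = f x - g x by [].
apply: (iffP (asboolP _)); apply: (@filterS _ _ FF) => x; rewrite fgE.
  by move/eqP; rewrite subr_eq0 => /eqP.
by move=> ->; rewrite subrr.
Qed.

Definition L1T_scale (c : R[i]) := lift_op1 L1T ( *:%R c).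

Lemma pi_L1T_scale c : {morph \pi_L1T : f / c *: f >-> L1T_scale c f}.
Proof.
move=> f; unlock L1T_scale; apply/eqP/L1T_eqP.
have /eqP/L1T_eqP : \pi_L1T (repr (\pi_L1T f)) = \pi_L1T f by rewrite reprK.
apply: (@filterS _ _ FF) => x ffx.
have sE (g : calL1T) : (c *: g) x = c * g x by [].
by rewrite !sE ffx.
Qed.
Canonical pi_L1T_scale_morph c := PiMorph1 (pi_L1T_scale c).

Fact L1T_scaleA c d f : L1T_scale c (L1T_scale d f) = L1T_scale (c * d) f.
Proof. by rewrite -[f]reprK !piE scalerA. Qed.
Fact L1T_scale1 : left_id 1 L1T_scale.
Proof. by move=> f; rewrite -[f]reprK !piE scale1r. Qed.
Fact L1T_scaleDr : right_distributive L1T_scale +%R.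
Proof. by move=> c f g; rewrite -[f]reprK -[g]reprK !piE scalerDr. Qed.
Fact L1T_scaleDl f : {morph L1T_scale^~ f : c d / c + d}.
Proof. by move=> c d; rewrite -[f]reprK !piE scalerDl. Qed.

HB.instance Definition _ := GRing.Zmodule_isLmodule.Build R[i] L1T
  L1T_scaleA L1T_scale1 L1T_scaleDr L1T_scaleDl.

(* [repr f] is some representative of the class f; see [L1T_normE]. *)
Definition L1T_norm (f : L1T) : R :=
  (2 * pi)^-1 * \int[mu]_(x in `[- pi, pi]) Normc.normc (repr f x).

Fact translate_subproof (a : R) (f : calL1T) :
  (fun x => f (x + a)) \in L1T_fun.
Proof.
have /asboolP[pf mrf mif irf iif] := calL1T_valP f.
apply/asboolP; split.
- by move=> x; rewrite addrAC pf.
- exact: (measurableT_comp mrf (measurable_sh a)).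
- exact: (measurableT_comp mif (measurable_sh a)).
- by apply: (integrable_periodic_shift a _ mrf irf) => x; rewrite pf.
- by apply: (integrable_periodic_shift a _ mif iif) => x; rewrite pf.
Qed.

Definition calL1T_translate (a : R) (f : calL1T) : calL1T :=
  CalL1T (translate_subproof a f).

(* f |-> f(. + a); an element of R/2piZ is given by any real representative a,
   see [translateD2pi]. The quotient map R -> R/2piZ is continuous and open, so
   limits as b --> a in R/2piZ are the limits taken over representatives. *)
Definition translate (a : R) := lift_op1 L1T (calL1T_translate a).

Lemma pi_translate a :
  {morph \pi_L1T : f / calL1T_translate a f >-> translate a f}.
Proof.
move=> f; unlock translate; apply/eqP/L1T_eqP.
have /eqP/L1T_eqP : \pi_L1T (repr (\pi_L1T f)) = \pi_L1T f by rewrite reprK.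
by move=> /(ae_shift a) /=; apply: (@filterS _ _ FF) => x ->.
Qed.
Canonical pi_translate_morph a := PiMorph1 (pi_translate a).

Lemma translateD2pi a : translate (a + 2 * pi) = translate a.
Proof.
apply/funext => f; rewrite -[f]reprK !piE; apply/eqP/L1T_eqP/aeW => x /=.
by have /asboolP[pf _ _ _ _] := calL1T_valP (repr f); rewrite addrA pf.
Qed.

Lemma L1T_normE (f : calL1T) : L1T_norm (\pi f) =
  (2 * pi)^-1 * \int[mu]_(x in `[- pi, pi]) Normc.normc (f x).
Proof.
have mnorm (g : calL1T) (D : set (measurableTypeR R)) :
    measurable_fun D (fun x => (Normc.normc (g x))%:E).
  have /asboolP[_ mr mi _ _] := calL1T_valP g.
  have mn : measurable_fun setT (fun x : R => Normc.normc (g x)).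
    rewrite (_ : (fun x => _) = Num.sqrt \o
      (fun x => complex.Re (g x) ^+ 2 + complex.Im (g x) ^+ 2)); last first.
      by apply/funext => x /=; case: (g x).
    apply: measurableT_comp.
      by apply: continuous_measurable_fun; exact: sqrt_continuous.
    by apply: measurable_funD; exact: measurable_funM.
  by apply: measurable_funTS; apply/measurable_EFinP; exact: mn.
congr (_ * fine _); apply: ae_eq_integral => //.
have /eqP/L1T_eqP : \pi_L1T (repr (\pi_L1T f)) = \pi_L1T f by rewrite reprK.
by apply: (@filterS _ _ FF) => x -> _.
Qed.

End calL1.

Definition is_norm (R : realType) (V : lmodType R[i]) (N : V -> R) :=
  [/\ forall f, 0 <= N f,
      forall f, N f = 0 -> f = 0,
      forall c f, N (c *: f) = Normc.normc c * N f &
      forall f g, N (f + g) <= N f + N g].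

Definition equivalent_norms (R : realType) (V : Type) (N1 N2 : V -> R) :=
  exists m M : R, [/\ 0 < m, 0 < M &
    forall f, m * N1 f <= N2 f /\ N2 f <= M * N1 f].

(* A Banach space whose vectors are the elements of the linear subspace S of V,
   with the linear structure of V and a norm of its own; val : U -> V is the
   inclusion. *)
#[short(type="subBanachType")]
HB.structure Definition SubBanach (K : numFieldType) (V : lmodType K)
    (S : {pred V}) :=
  { U of CompleteNormedModule K U & @GRing.SubLmodule K V S U }.

Definition translation_invariant (R : realType) (S : {pred L1T R}) :=
  forall (a : R) (f : L1T R), f \in S -> translate a f \in S.

Section subspaces_of_L1T.
Context {R : realType} {S : submodClosed (L1T R)} {X : subBanachType S}.

(* The library norm takes values in R[i]; they are real and nonnegative. *)
Definition banach_norm (f : X) : R := complex.Re `|f|.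

Definition translateX (tS : translation_invariant S) (a : R) (f : X) : X :=
  Sub (translate a (val f)) (tS a (val f) (valP f)).

End subspaces_of_L1T.

(* Main.v *)
Require Import Defs.
From mathcomp Require Import all_boot all_order all_algebra.
From mathcomp Require Import generic_quotient.
From mathcomp Require Import all_classical all_reals all_analysis.
From mathcomp Require Import complex measurable_realfun.
From mathcomp Require Import lra ring.
Set Implicit Arguments.
Unset Strict Implicit.
Unset Printing Implicit Defensive.
Import Order.TTheory GRing.Theory Num.Theory.
Import numFieldNormedType.Exports.
Local Open Scope classical_set_scope.
Local Open Scope ring_scope.

(* Given (H1* ) and (H3* ), the new norm is c times the supremum over a of
   |f(. + a)|_X. This supremum is finite because the orbit of f is continuous
   by (H3* ) and periodic. It is bounded by a multiple of |f|_X by Zabreiko's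
   lemma: a countably subadditive seminorm on a Banach space is bounded. No
   translation is known to be bounded on X beforehand; countable subadditivity
   holds because translations are isometries of L^1, into which X embeds
   continuously by (H1* ), so that their graphs in X are closed. *)

(** * Baire category and Zabreiko's lemma for a complete norm *)

Section norms.
Context {R : realType} {V : lmodType R[i]} (N : V -> R).

(** Completeness is phrased through the real-valued [N] alone. Comparing with the single term [u n]
    is the usual Cauchy condition up to a factor 2 in [e]. *)
Definition seq_complete := forall u : nat -> V,
  (forall e, 0 < e -> exists n, forall m, (n <= m)%N -> N (u m - u n) < e) ->
  exists l, N (u n - l) @[n --> \oo] --> (0 : R).

Hypothesis normN : is_norm N.
Implicit Types f g h : V.

Lemma is_norm_ge0 f : 0 <= N f. Proof. by case: normN. Qed.

Lemma is_norm_eq0 f : N f = 0 -> f = 0.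
Proof. by case: normN => _ + _ _; exact. Qed.

Lemma is_normZ c f : N (c *: f) = Normc.normc c * N f.
Proof. by case: normN. Qed.

Lemma is_normD f g : N (f + g) <= N f + N g. Proof. by case: normN. Qed.

Lemma is_norm0 : N 0 = 0.
Proof. by rewrite -(scale0r 0) is_normZ Normc.normc0 mul0r. Qed.

Lemma is_normNE f : N (- f) = N f.
Proof. by rewrite -scaleN1r is_normZ normcN Normc.normc1 mul1r. Qed.

Lemma is_norm_distC f g : N (f - g) = N (g - f).
Proof. by rewrite -is_normNE opprB. Qed.

Lemma is_norm_distD h f g : N (f - g) <= N (f - h) + N (h - g).
Proof. by rewrite -[f - g](subrKA h); exact: is_normD. Qed.

Lemma is_norm_sum n (u : nat -> V) :
  N (\sum_(k < n) u k) <= \sum_(k < n) N (u k).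
Proof.
elim: n => [|n IH]; first by rewrite !big_ord0 is_norm0.
by rewrite !big_ord_recr /=; apply: le_trans (is_normD _ _) _; rewrite lerD2r.
Qed.

Lemma is_norm_cvg0P (u : nat -> V) : N (u n) @[n --> \oo] --> (0 : R) <->
  forall e, 0 < e -> exists n, forall m, (n <= m)%N -> N (u m) < e.
Proof.
split=> [/cvgr0Pnorm_lt H e /H [n _ Hn]|H].
  by exists n => m /Hn; rewrite /= ger0_norm// is_norm_ge0.
apply/cvgr0Pnorm_lt => e /H[n Hn]; exists n => // m /Hn.
by rewrite /= ger0_norm// is_norm_ge0.
Qed.

Hypothesis completeN : seq_complete.

(** Otherwise no [E n] is dense in any ball, and balls can be nested so that the closed one of index
    n+1 misses [E n]. Completeness gives a common point, which contradicts the cover. *)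
Lemma baire_dense_ball (E : nat -> V -> Prop) : (forall f, exists n, E n f) ->
  exists n x r, 0 < r /\ forall y, N (y - x) < r ->
    forall e, 0 < e -> exists2 z, E n z & N (z - y) < e.
Proof.
move=> coverE; apply: contrapT => nodense.
(* The positivity guard sits under the existential so that [choice] yields a total function; for
   nonpositive radii any value does. *)
have step (np : nat * (V * R)) : exists q : V * R, 0 < np.2.2 ->
    [/\ 0 < q.2, q.2 <= np.1.+2%:R^-1, N (q.1 - np.2.1) + q.2 <= np.2.2 &
      forall z, N (z - q.1) <= q.2 -> ~ E np.1 z].
  case: np => n [x r] /=.
  have [r0|] := pselect (0 < r); last by exists (0, 0).
  have [y [s [yx s0 sE]]] : exists y s, [/\ N (y - x) < r, 0 < s &
      forall z, E n z -> s <= N (z - y)].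
    apply: contrapT => H; apply: nodense; exists n, x, r; split=> // y yx e e0.
    apply: contrapT => H'; apply: H; exists y, e; split=> // z Ez.
    by rewrite leNgt; apply/negP => ze; apply: H'; exists z.
  (* The three bounds keep the new ball inside the old one, make even its closure miss [E n], and
     send the radii to 0. *)
  exists (y, Num.min (Num.min (r - N (y - x)) (s / 2)) n.+2%:R^-1) => _ /=.
  split.
  - by rewrite !lt_min subr_gt0 yx divr_gt0// invr_gt0 ltr0n.
  - by rewrite ge_min lexx orbT.
  - by rewrite -lerBrDl !ge_min lexx.
  - move=> z; rewrite !le_min => /andP[/andP[_ zs] _] /sE.
    by move=> /le_trans/(_ zs); apply/negP; rewrite -ltNge; lra.
have [F FP] := choice step.
pose p := fix p n := if n is m.+1 then F (m, p m) else (0, 1) : V * R.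
have p0 n : 0 < (p n).2.
  by elim: n => [|n IH] /=; [exact: ltr01|case: (FP (n, p n) IH)].
have pn n : (p n).2 <= n.+1%:R^-1.
  by case: n => [|n] /=; [rewrite invr1|case: (FP (n, p n) (p0 n))].
(* Adding the inner radius to the distance of the centres makes the induction telescope. *)
have ball n k : N ((p (n + k)%N).1 - (p n).1) + (p (n + k)%N).2 <= (p n).2.
  elim: k => [|k IH]; first by rewrite addn0 subrr is_norm0 add0r.
  apply: le_trans IH; rewrite addnS /=.
  case: (FP ((n + k)%N, p (n + k)%N) (p0 _)) => /= _ _ + _.
  set q := F _; have := is_norm_distD (p (n + k)%N).1 q.1 (p n).1.
  by rewrite /q; lra.
have pmn m n : (n <= m)%N -> N ((p m).1 - (p n).1) <= (p n).2.
  move=> /subnKC <-.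
  by have := ball n (m - n)%N; have := p0 (n + (m - n))%N; lra.
have [e e0|l] := completeN (u := fun n => (p n).1).
  have [n _ /(_ n (leqnn _)) /= ne] := near_infty_natSinv_lt (PosNum e0).
  by exists n => m /pmn /le_lt_trans; apply; apply: le_lt_trans ne.
move/is_norm_cvg0P => pl.
have lp n : N (l - (p n).1) <= (p n).2.
  apply/ler_addgt0Pr => e /pl[m Hm].
  have := Hm _ (leq_maxl m n); have := pmn _ _ (leq_maxr m n).
  rewrite (is_norm_distC _ l).
  by have := is_norm_distD (p (maxn m n)).1 l (p n).1; lra.
have [n] := coverE l.
(* The closed ball of index n+1 contains [l] and misses [E n]. *)
by case: (FP (n, p n) (p0 n)) => /= _ _ _; apply; exact: (lp n.+1).
Qed.

(* Zabreiko's lemma: by Baire some sublevel set of L is dense in a ball, so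
   every f is a series of approximants u k with L (u k) = O(2^-k N f). *)
Lemma countably_subadditive_bounded (L : V -> R) :
  (forall c f, L (c *: f) = Normc.normc c * L f) ->
  (forall f g, L (f + g) <= L f + L g) ->
  (forall (u : nat -> V) f B,
    N (f - \sum_(k < n) u k) @[n --> \oo] --> (0 : R) ->
    (forall n, \sum_(k < n) L (u k) <= B) -> L f <= B) ->
  exists2 C, 0 < C & forall f, L f <= C * N f.
Proof.
move=> LZ LD Lsum.
have L0 : L 0 = 0 by rewrite -(scale0r 0) LZ Normc.normc0 mul0r.
have LN f : L (- f) = L f.
  by rewrite -scaleN1r LZ normcN Normc.normc1 mul1r.
have L_ge0 f : 0 <= L f by have := LD f (- f); rewrite subrr L0 LN; lra.
have normcR (t : R) : 0 <= t -> Normc.normc t%:C%C = t.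
  by move=> t0; rewrite /= expr0n addr0 sqrtr_sqr ger0_norm.
have [n [x [r [r0 dense]]]] : exists n x r, 0 < r /\ forall y, N (y - x) < r ->
    forall e, 0 < e -> exists2 z, L z <= n%:R & N (z - y) < e.
  apply: (baire_dense_ball (E := fun n z => L z <= n%:R)) => f.
  by exists (Num.truncn (L f)).+1; rewrite ltW// truncnS_gt.
(* Density near [x] is moved to any [z] by homogeneity: with [y = z / t] of norm r/2, approximate
   [x + y] and [x], subtract, and scale back by [t]. *)
have approx : exists2 C, 0 < C & forall z e, 0 < e ->
    exists2 w, L w <= C * N z & N (z - w) < e.
  (* Comes from [t = 2 * N z / r] times the bound 2(n+1) on [L (w1 - w2)]; n+1 rather than n keeps
     the constant positive. *)
  exists (4 * n.+1%:R / r) => [|z e e0]; first by rewrite divr_gt0// mulr_gt0.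
  have [z0|z0] := eqVneq (N z) 0.
    by exists 0; rewrite ?L0 ?z0 ?mulr0 ?subr0 ?z0.
  have {}z0 : 0 < N z by rewrite lt_def z0 is_norm_ge0.
  pose t := 2 * N z / r; have t0 : 0 < t by rewrite divr_gt0// mulr_gt0.
  have tr : t * r = 2 * N z by rewrite /t mulfVK// gt_eqF.
  pose y := (t^-1)%:C%C *: z.
  have yr : N y < r.
    rewrite is_normZ normcR ?invr_ge0 ?ltW// mulrC ltr_pdivrMr// mulrC tr; lra.
  (* Two such errors, scaled by [t], add up to [e]. *)
  have e't : 0 < e / t / 2 by rewrite divr_gt0// divr_gt0.
  have [w1 Lw1 w1y] := dense (x + y) ltac:(by rewrite addrC addKr) _ e't.
  have [w2 Lw2 w2x] := dense x ltac:(by rewrite subrr is_norm0) _ e't.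
  exists (t%:C%C *: (w1 - w2)).
    rewrite LZ (normcR _ (ltW t0)).
    have -> : 4 * n.+1%:R / r * N z = t * (2 * n.+1%:R) by rewrite /t; ring.
    rewrite ler_pM2l//; have := LD w1 (- w2); rewrite LN -natr1; lra.
  have -> : z - t%:C%C *: (w1 - w2) = t%:C%C *: (y - (w1 - w2)).
    by rewrite [RHS]scalerBr scalerA -rmorphM divff ?gt_eqF// scale1r.
  rewrite is_normZ (normcR _ (ltW t0)) mulrC -ltr_pdivlMr//.
  have -> : y - (w1 - w2) = (x + y - w1) - (x - w2).
    by rewrite (addrC x) -2!(addrA y) !opprB [x - w1 + _]addrC subrKA.
  apply: le_lt_trans (is_normD _ _) _; rewrite is_normNE.
  by rewrite (is_norm_distC _ w1) (is_norm_distC x); lra.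
case: approx => C C0 approx {n x r r0 dense}.
exists (2 * C) => [|f]; first by rewrite mulr_gt0.
have [Nf|Nf] := eqVneq (N f) 0.
  by rewrite (is_norm_eq0 Nf) L0 is_norm0 mulr0.
have {}Nf : 0 < N f by rewrite lt_def Nf is_norm_ge0.
have /choice[G GP] (ze : V * R) : exists w, 0 < ze.2 ->
    L w <= C * N ze.1 /\ N (ze.1 - w) < ze.2.
  case: ze => z e /=; have [e0|] := pselect (0 < e); last by exists 0.
  by have [w ? ?] := approx z e e0; exists w.
pose eps k := N f * 2^-1 ^+ k.
have eps0 k : 0 < eps k by rewrite mulr_gt0// exprn_gt0.
(* [g k] is what remains of [f] after k approximants, and [u k] approximates [g k] to within
   [eps k.+1]. *)
pose g := fix g k := if k is j.+1 then g j - G (g j, eps k) else f.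
pose u k := G (g k, eps k.+1).
have gN k : N (g k) <= eps k.
  case: k => [|k]; first by rewrite /eps expr0 mulr1.
  exact/ltW/(GP (_, eps _) (eps0 _)).2.
have gE n : f - \sum_(k < n) u k = g n.
  elim: n => [|n IH]; first by rewrite big_ord0 subr0.
  by rewrite big_ord_recr opprD addrA IH.
apply: (Lsum u) => [|n].
  under eq_fun do rewrite gE.
  apply: (@squeeze_cvgr _ _ _ _ (cst 0) eps).
  - by near=> n; rewrite is_norm_ge0 gN.
  - exact: cvg_cst.
  - by apply: cvg_geometric; rewrite ger0_norm; lra.
(* The bound is strengthened for the induction: [eps k = 2 * (eps k - eps k.+1)], so the terms
   [C * eps k] telescope. *)
apply: (@le_trans _ _ (2 * C * (N f - eps n))); last first.
  by rewrite ler_pM2l ?mulr_gt0// gerBl ltW.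
elim: n => [|n IH].
  by rewrite big_ord0 /eps expr0 mulr1 subrr mulr0.
rewrite big_ord_recr /=.
have [+ _] := GP (g n, eps n.+1) (eps0 _); rewrite -/(u n) /= => Lu.
have := ler_wpM2l (ltW C0) (gN n).
have -> : eps n.+1 = eps n / 2 by rewrite /eps exprS; field.
by move: IH; lra.
Unshelve. all: by end_near. Qed.

End norms.

(** * Translation invariance of the integral over a period *)

Section periodic_integral.
Context {R : realType}.
Local Notation mu := (@lebesgue_measure R).
Variable g : R -> R.
Hypotheses (mg : measurable_fun setT g) (g_ge0 : forall x, 0 <= g x).

Let mgE (D : set (measurableTypeR R)) : measurable_fun D (fun x => (g x)%:E).
Proof. by apply/measurable_EFinP; exact: measurable_funTS. Qed.

Lemma ge0_integral_itv_shift (a u v : R) :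
  (\int[mu]_(x in `[u, v]) (g (x + a)%R)%:E =
   \int[mu]_(x in `[(u + a)%R, (v + a)%R]) (g x)%:E)%E.
Proof.
pose nu := measure_function_pushforward__canonical__measure_function_Measure
  mu (measurable_sh a).
have -> : (\int[mu]_(x in `[(u + a)%R, (v + a)%R]) (g x)%:E =
    \int[nu]_(x in `[(u + a)%R, (v + a)%R]) (g x)%:E)%E.
  apply: (eq_measure_integral nu) => A mA _ /=.
  by rewrite /nu /= lebesgue_measure_sh.
rewrite (ge0_integral_pushforward (measurable_sh a))//=.
- congr (integral _ _ _); apply/seteqP; split => x /=; rewrite !in_itv /=;
  by rewrite !lerD2r.
- by move=> x _; rewrite lee_fin.
Qed.

Lemma ge0_integral_itv_cat (u v w : R) : u <= v -> v <= w ->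
  (\int[mu]_(x in `[u, w]) (g x)%:E =
   \int[mu]_(x in `[u, v]) (g x)%:E + \int[mu]_(x in `[v, w]) (g x)%:E)%E.
Proof.
(* Removing the null point [v] from the second interval makes the union disjoint. *)
move=> uv vw; rewrite -(@integral_itv_obnd_cbnd _ v); last exact: mgE.
rewrite -ge0_integral_setU//=.
- congr (integral _ _ _); apply/seteqP; split => x /=; rewrite !in_itv /=.
    by move=> /andP[ux xw]; case: (leP x v) => xv; [left|right];
      rewrite ?ux ?xv.
  by case=> /andP[h1 h2]; apply/andP; split; lra.
- by move=> x _; rewrite lee_fin.
- rewrite disj_set2E; apply/eqP/seteqP; split=> // x /=; rewrite !in_itv /=.
  by case=> /andP[_ h1] /andP[h2 _]; move: h1; rewrite leNgt h2.
Qed.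

Hypothesis g_per : forall x, g (x + 2 * pi) = g x.

(** Reduce [a] modulo 2 pi to [b] in [0, 2 pi], cut the shifted window [-pi + b, pi + b] at pi, and
    move the piece beyond pi back by one period. *)
Lemma ge0_integral_periodic_shift (a : R) :
  (\int[mu]_(x in `[(- pi)%R, pi%R]) (g (x + a)%R)%:E =
   \int[mu]_(x in `[(- pi)%R, pi%R]) (g x)%:E)%E.
Proof.
have pi0 : 0 < pi :> R := pi_gt0 R.
pose k := Num.floor (a / (2 * pi)); pose b := a - 2 * pi * k%:~R.
have /andP[] := floor_itv (a / (2 * pi)); rewrite -/k.
rewrite ler_pdivlMr ?mulr_gt0// ltr_pdivrMr ?mulr_gt0// intrD mulr1z => h1 h2.
have [b0 b1] : 0 <= b /\ b <= 2 * pi by rewrite /b; lra.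
transitivity (\int[mu]_(x in `[(- pi)%R, pi%R]) (g (x + b)%R)%:E)%E.
  apply: eq_integral => x _; rewrite -(periodic_int k g_per (x + b)).
  by rewrite /b -addrA subrK.
rewrite ge0_integral_itv_shift.
rewrite (@ge0_integral_itv_cat _ pi); [|lra|lra].
rewrite [RHS](@ge0_integral_itv_cat _ (- pi + b) pi); [|lra|lra].
rewrite addeC; congr (_ + _)%E.
have {1}-> : pi = - pi + 2 * pi :> R by ring.
have -> : pi + b = - pi + b + 2 * pi :> R by ring.
rewrite -ge0_integral_itv_shift.
by apply: eq_integral => x _; rewrite g_per.
Qed.

End periodic_integral.

(** * The norm of L^1(T) and translations on it *)

Section L1T_norm.
Context {R : realType}.
Local Notation mu := (@lebesgue_measure R).
Local Open Scope quotient_scope.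

Let mI : measurable (`[- pi, pi]%classic : set (measurableTypeR R)).
Proof. exact: measurable_itv. Qed.

Let FF := ae_filter_ringOfSetsType mu.

Lemma calL1T_periodic (f : calL1T R) x : f (x + 2 * pi) = f x.
Proof. by have /asboolP[pf _ _ _ _] := calL1T_valP f. Qed.

Lemma measurable_normc_calL1T (f : calL1T R) :
  measurable_fun setT (fun x => Normc.normc (f x)).
Proof.
have /asboolP[_ mr mi _ _] := calL1T_valP f.
rewrite (_ : (fun x => _) = Num.sqrt \o
  (fun x => complex.Re (f x) ^+ 2 + complex.Im (f x) ^+ 2)); last first.
  by apply/funext => x /=; case: (f x).
apply: measurableT_comp; last by apply: measurable_funD; exact: measurable_funM.
by apply: continuous_measurable_fun; exact: sqrt_continuous.
Qed.

Lemma normc_ge0 (c : R[i]) : 0 <= Normc.normc c.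
Proof. by case: c => a b; exact: sqrtr_ge0. Qed.

Lemma normc_le_ReIm (c : R[i]) :
  Normc.normc c <= `|complex.Re c| + `|complex.Im c|.
Proof.
case: c => a b /=; rewrite -[leRHS]ger0_norm ?addr_ge0// -sqrtr_sqr.
rewrite ler_sqrt ?sqr_ge0// sqrrD !real_normK ?num_real//.
by rewrite lerD2r lerDl mulrn_wge0// mulr_ge0.
Qed.

Lemma integrable_normc_calL1T (f : calL1T R) :
  mu.-integrable `[- pi, pi] (fun x => (Normc.normc (f x))%:E).
Proof.
have /asboolP[_ mr mi ir ii] := calL1T_valP f.
have := integrableD mI (integrable_abse ir) (integrable_abse ii).
apply: le_integrable => //.
  apply/measurable_EFinP; apply: measurable_funTS.
  exact: measurable_normc_calL1T.
move=> x _ /=; rewrite lee_fin (ger0_norm (normc_ge0 _)).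
rewrite (ger0_norm (addr_ge0 _ _))//.
exact: normc_le_ReIm.
Qed.

Lemma L1T_norm_ge0 (f : L1T R) : 0 <= L1T_norm f.
Proof.
apply: mulr_ge0; first by rewrite invr_ge0 mulr_ge0// pi_ge0.
by apply: Rintegral_ge0 => x _; exact: normc_ge0.
Qed.

Lemma L1T_normD (f g : L1T R) : L1T_norm (f + g) <= L1T_norm f + L1T_norm g.
Proof.
rewrite -[f]reprK -[g]reprK !piE !L1T_normE -mulrDr ler_pM2l; last first.
  by rewrite invr_gt0 mulr_gt0// pi_gt0.
rewrite -RintegralD//; [|exact: integrable_normc_calL1T..].
apply: le_Rintegral => //; first exact: integrable_normc_calL1T.
  exact: (integrableD mI (integrable_normc_calL1T _)
    (integrable_normc_calL1T _)).
by move=> x _; exact: le_normcD.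
Qed.

(** A zero integral gives vanishing almost everywhere on one period, whereas equality in [L1T] is
    almost everywhere on the whole line. Countably many translates of the exceptional set remain
    null, and periodicity does the rest. *)
Lemma L1T_norm_eq0 (f : L1T R) : L1T_norm f = 0 -> f = 0.
Proof.
rewrite -[f]reprK L1T_normE => /eqP.
set g := repr f; rewrite mulf_eq0 invr_eq0 mulf_eq0 pnatr_eq0 /=.
rewrite gt_eqF ?pi_gt0//= fine_eq0; last first.
  exact: integrable_fin_num (integrable_normc_calL1T g).
move=> /eqP g0.
have {g0} : {ae mu, forall x, x \in `[- pi, pi] -> Normc.normc (g x) = 0}.
  have : ae_eq mu `[- pi, pi]%classic (fun x => (Normc.normc (g x))%:E) (cst 0).
    apply/ae_eq_integral_abs => //.
      apply/measurable_EFinP; apply: measurable_funTS.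
      exact: measurable_normc_calL1T.
    rewrite -[RHS]g0; apply: eq_integral => x _.
    by rewrite /= ger0_norm// normc_ge0.
  by apply: filterS => x /= + xpi => /(_ xpi) [].
pose P (x : R) := x \in `[- pi, pi] -> Normc.normc (g x) = 0.
move=> g0.
(* Both signs are listed because [ae_foralln] intersects over natural numbers, while integer
   multiples of the period are needed. *)
have g0k : {ae mu, forall x, forall n : nat,
    P (x + 2 * pi * n%:~R) /\ P (x + 2 * pi * - n%:~R)}.
  by apply: ae_foralln => n; apply: (@filterI _ _ FF);
    exact: (ae_shift _ (P := P)).
have -> : 0 = \pi_(L1T R) 0 by rewrite piE.
apply/eqP/L1T_eqP; apply: (@filterS _ _ FF _ _ _ g0k) => x Px.
apply: Normc.eq0_normc; have pi0 : 0 < pi :> R := pi_gt0 R.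
have gper y : Normc.normc (g (y + 2 * pi)) = Normc.normc (g y).
  by rewrite calL1T_periodic.
pose k := - Num.floor ((x + pi) / (2 * pi)).
have /andP[] := floor_itv ((x + pi) / (2 * pi)).
rewrite ler_pdivlMr ?mulr_gt0// ltr_pdivrMr ?mulr_gt0// intrD mulr1z => h1 h2.
have xk : x + 2 * pi * k%:~R \in `[- pi, pi].
  by rewrite in_itv /= /k mulrNz; apply/andP; split; lra.
rewrite -(periodic_int k gper).
case: k xk => n xk; first exact: (Px n).1.
by move: xk; rewrite NegzE mulrNz => xk; exact: (Px n.+1).2.
Qed.

Lemma L1T_norm_translate (a : R) (f : L1T R) :
  L1T_norm (translate a f) = L1T_norm f.
Proof.
rewrite -[f]reprK !piE !L1T_normE; congr (_ * fine _).
apply: (@ge0_integral_periodic_shift _ (fun x => Normc.normc (repr f x))).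
- exact: measurable_normc_calL1T.
- by move=> x; exact: normc_ge0.
- by move=> x; rewrite calL1T_periodic.
Qed.

Lemma translateD (a : R) : {morph translate a : f g / f + g >-> f + g}.
Proof.
by move=> f g; rewrite -[f]reprK -[g]reprK !piE; congr (\pi _); apply: val_inj.
Qed.

Lemma translateZ (a : R) c (f : L1T R) :
  translate a (c *: f) = c *: translate a f.
Proof.
have ZE (g : calL1T R) : c *: \pi_(L1T R) g = \pi_(L1T R) (c *: g).
  exact/esym/pi_L1T_scale.
by rewrite -[f]reprK ZE !piE ZE; congr (\pi _); apply: val_inj.
Qed.

Lemma translate0 (f : L1T R) : translate 0 f = f.
Proof.
by rewrite -[f]reprK !piE; apply/eqP/L1T_eqP/aeW => x /=; rewrite addr0.
Qed.

Lemma translate_translate (a b : R) (f : L1T R) :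
  translate a (translate b f) = translate (a + b) f.
Proof.
by rewrite -[f]reprK !piE; apply/eqP/L1T_eqP/aeW => x /=; rewrite addrA.
Qed.

End L1T_norm.

(** * Translations on X and the supremum of the norm over an orbit *)

Section translation_of_subspace.
Context {R : realType} {S : submodClosed (L1T R)} {X : subBanachType S}.
Implicit Types f g : X.

Lemma normc_normE (c : R[i]) : `|c| = (Normc.normc c)%:C%C.
Proof. by []. Qed.

Lemma ge0_complexE (c : R[i]) : 0 <= c -> c = (complex.Re c)%:C%C.
Proof. by move=> c0; rewrite RRe_real// ger0_real. Qed.

Lemma banach_normE f : `|f| = (banach_norm f)%:C%C.
Proof. exact/ge0_complexE/normr_ge0. Qed.

Lemma banach_norm_is_norm : is_norm (@banach_norm R S X).
Proof.
split=> [f|f f0|c f|f g].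
- have := normr_ge0 f; rewrite banach_normE lecE /=; by case/andP.
- by apply: normr0_eq0; rewrite banach_normE f0.
- have := normrZ c f; rewrite !banach_normE normc_normE -rmorphM.
  by move=> /(congr1 (@complex.Re R)).
- by have := ler_normD f g; rewrite !banach_normE -rmorphD lecE /= eqxx.
Qed.

Lemma banach_norm_complete : seq_complete (@banach_norm R S X).
Proof.
move=> u cu.
have /cauchy_cvgP : cauchy (u @ \oo).
  apply: cauchy_exP => e e0.
  have eE := ge0_complexE (ltW e0); move: e0; rewrite eE ltcR => e0.
  have [n un] := cu _ e0; exists (u n), n => // m /un.
  rewrite -ball_normE /= banach_normE ltcR.
  by rewrite -(is_norm_distC banach_norm_is_norm).
move=> /cvgrPdist_lt ul; exists (lim (u @ \oo)).
apply/(is_norm_cvg0P banach_norm_is_norm) => e e0.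
have [|n _ un] := ul e%:C%C; first by rewrite ltcR.
exists n => m /un.
by rewrite /= banach_normE ltcR (is_norm_distC banach_norm_is_norm).
Qed.

Variable tS : translation_invariant S.
Local Notation T := (translateX (X := X) tS).

Lemma val_translateX a f : val (T a f) = translate a (val f).
Proof. exact: SubK. Qed.

Let valD f g : val (f + g) = val f + val g. Proof. exact: GRing.valD. Qed.
Let valZ c f : val (c *: f) = c *: val f. Proof. exact: GRing.valZ. Qed.

Lemma translateXD a f g : T a (f + g) = T a f + T a g.
Proof. by apply: val_inj; rewrite !(valD, val_translateX) translateD. Qed.

Lemma translateXZ a c f : T a (c *: f) = c *: T a f.
Proof. by apply: val_inj; rewrite !(valZ, val_translateX) translateZ. Qed.

Lemma translateX0 f : T 0 f = f.
Proof. by apply: val_inj; rewrite val_translateX translate0. Qed.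

Lemma translateX_translateX a b f : T a (T b f) = T (a + b) f.
Proof. by apply: val_inj; rewrite !val_translateX translate_translate. Qed.

Lemma translateXD2pi a f : T (a + 2 * pi) f = T a f.
Proof. by apply: val_inj; rewrite !val_translateX translateD2pi. Qed.

Lemma translateXB a f g : T a (f - g) = T a f - T a g.
Proof. by rewrite translateXD -scaleN1r translateXZ scaleN1r. Qed.

Lemma translateX_sum a n (u : nat -> X) :
  T a (\sum_(k < n) u k) = \sum_(k < n) T a (u k).
Proof.
elim: n => [|n IH]; last by rewrite !big_ord_recr /= translateXD IH.
by rewrite !big_ord0 -[Z in T a Z](subrr 0) translateXB subrr.
Qed.

Lemma L1T_norm_valD f g :
  L1T_norm (val (f + g)) <= L1T_norm (val f) + L1T_norm (val g).
Proof. by rewrite valD; exact: L1T_normD. Qed.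

(** The least translation-invariant function above [banach_norm], once [orbit_bounded] makes [sup] a
    genuine supremum. *)
Definition orbit_norm f := sup (range (fun a => banach_norm (T a f))).

Hypothesis T0 : forall f, banach_norm (T a f - f) @[a --> (0 : R)] --> (0 : R).

(** By the group law this is continuity at 0 for the vector [T a f], so no bound on the operator
    [T a] enters. *)
Lemma translateX_cvg f a :
  banach_norm (T b f - T a f) @[b --> a] --> (0 : R).
Proof.
have -> : (fun b => banach_norm (T b f - T a f)) =
    (fun h => banach_norm (T h (T a f) - T a f)) \o (fun b => b - a).
  by apply/funext => b /=; rewrite translateX_translateX subrK.
apply: cvg_comp (T0 (T a f)).
by rewrite -{2}(subrr a); apply: cvgB; [exact: cvg_id|exact: cvg_cst].
Qed.

(** The norm along the orbit is continuous, so it has a maximum on [0, 2 pi], and periodicity makes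
    that maximum global. *)
Lemma orbit_bounded f : has_ubound (range (fun a => banach_norm (T a f))).
Proof.
pose F a := banach_norm (T a f).
have Fcont : continuous F.
  move=> a; apply/cvgrPdist_lt => e e0.
  have /cvgr0Pnorm_lt/(_ e e0) := @translateX_cvg f a.
  apply: filterS => b; apply: le_lt_trans; rewrite /F.
  have nX := banach_norm_is_norm; have n0 := is_norm_ge0 nX.
  have := is_normD nX (T b f - T a f) (T a f).
  have := is_normD nX (T a f - T b f) (T b f).
  rewrite !subrK (is_norm_distC nX (T a f)) (ger0_norm (n0 _)) => h1 h2.
  by rewrite ler_norml; apply/andP; split; lra.
have pi0 : 0 < pi :> R := pi_gt0 R.
have [||m _ Fm] := @EVT_max _ F 0 (2 * pi); first by rewrite mulr_ge0// ltW.
  exact: continuous_subspaceT.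
exists (F m) => _ [a _ <-]; rewrite -/(F a).
have Fper x : F (x + 2 * pi) = F x by rewrite /F translateXD2pi.
rewrite -(periodic_int (- Num.floor (a / (2 * pi))) Fper a) mulrNz.
have /andP[] := floor_itv (a / (2 * pi)).
rewrite ler_pdivlMr ?mulr_gt0// ltr_pdivrMr ?mulr_gt0// intrD mulr1z => h1 h2.
by apply: Fm; rewrite in_itv /=; apply/andP; split; lra.
Qed.

Lemma orbit_norm_ge a f : banach_norm (T a f) <= orbit_norm f.
Proof. by apply: (ub_le_sup (orbit_bounded f)); exists a. Qed.

Lemma orbit_norm_le f M :
  (forall a, banach_norm (T a f) <= M) -> orbit_norm f <= M.
Proof.
move=> H; apply: ge_sup => [|_ [a _ <-]//].
by exists (banach_norm (T 0 f)), 0.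
Qed.

Lemma banach_norm_le_orbit f : banach_norm f <= orbit_norm f.
Proof. by rewrite -{1}(translateX0 f) orbit_norm_ge. Qed.

Lemma orbit_norm_is_norm : is_norm orbit_norm.
Proof.
have nX := banach_norm_is_norm.
have ge0 f : 0 <= orbit_norm f.
  exact: le_trans (is_norm_ge0 nX f) (banach_norm_le_orbit f).
have leZ c f : orbit_norm (c *: f) <= Normc.normc c * orbit_norm f.
  apply: orbit_norm_le => a; rewrite translateXZ (is_normZ nX).
  by rewrite ler_wpM2l ?normc_ge0// orbit_norm_ge.
split=> // [f f0|c f|f g].
- apply: (is_norm_eq0 nX); apply/le_anti.
  by rewrite (is_norm_ge0 nX) -f0 banach_norm_le_orbit.
(* The reverse inequality is [leZ] for the scalar [c^-1] and the vector [c *: f]. *)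
- apply/le_anti; rewrite leZ /=.
  have [->|c0] := eqVneq c 0; first by rewrite Normc.normc0 mul0r.
  have nc0 : 0 < Normc.normc c.
    rewrite lt_def normc_ge0 andbT; apply: contra_neq c0.
    exact: Normc.eq0_normc.
  have := leZ c^-1 (c *: f).
  by rewrite scalerA mulVf// scale1r Normc.normcV mulrC ler_pdivlMr// mulrC.
- apply: orbit_norm_le => a; rewrite translateXD.
  by apply: le_trans (is_normD nX _ _) _; rewrite lerD// orbit_norm_ge.
Qed.

Lemma orbit_norm_translateX a f : orbit_norm (T a f) = orbit_norm f.
Proof.
apply/le_anti/andP; split; apply: orbit_norm_le => b.
  by rewrite translateX_translateX orbit_norm_ge.
by rewrite -(subrK a b) -translateX_translateX orbit_norm_ge.
Qed.

(** * Boundedness of the orbit norm, from the closed graph of each translation *)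

Variable c : R.
Hypotheses (c0 : 0 < c)
  (L1T_le : forall f : X, L1T_norm (val f) <= c * banach_norm f).

(** The series of the [T a (u k)] converges absolutely, hence to some [g] in X. In L^1, where [T a]
    is isometric, its sum is also [T a f]; so [T a f = g], and the bound passes to the limit. *)
Lemma translateX_series_le a (u : nat -> X) f M :
  banach_norm (f - \sum_(k < n) u k) @[n --> \oo] --> (0 : R) ->
  (forall n, \sum_(k < n) banach_norm (T a (u k)) <= M) ->
  banach_norm (T a f) <= M.
Proof.
have nX := banach_norm_is_norm.
move=> /(is_norm_cvg0P nX) uf uM.
pose s n := \sum_(k < n) T a (u k).
pose t n := \sum_(k < n) banach_norm (T a (u k)).
have st n d : banach_norm (s (n + d)%N - s n) <= t (n + d)%N - t n.
  elim: d => [|d IH]; first by rewrite addn0 !subrr (is_norm0 nX).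
  rewrite addnS /s /t !big_ord_recr /= -/(s _) -/(t _) addrAC [leRHS]addrAC.
  by apply: le_trans (is_normD nX _ _) _; rewrite lerD2r.
have [e e0|g /(is_norm_cvg0P nX) sg] := banach_norm_complete (u := s).
  (* Some [t n] is within [e] of the supremum of the partial sums of norms, which controls every
     later tail. *)
  have supt : has_sup (range t).
    by split; [exists (t 0), 0|exists M => _ [n _ <-]; exact: uM].
  have [_ [n _ <-] tn] := sup_adherent e0 supt.
  exists n => m /subnKC <-; apply: le_lt_trans (st _ _) _.
  move: tn; rewrite ltrBlDl ltrBlDr; apply: le_lt_trans.
  by apply: (ub_le_sup supt.2); exists (n + (m - n))%N.
have Tfg : T a f = g.
  apply/eqP; rewrite -subr_eq0; apply/eqP/val_inj.
  rewrite [RHS](_ : _ = 0); last exact: GRing.val0.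
  apply: L1T_norm_eq0; apply/le_anti; rewrite L1T_norm_ge0 andbT.
  apply/ler_addgt0Pr => e e0; rewrite add0r.
  (* Passing from X to L^1 costs a factor [c], and two errors are added. *)
  have e'0 : 0 < e / c / 2 by rewrite divr_gt0// divr_gt0.
  have [n1 un] := uf _ e'0; have [n2 sn] := sg _ e'0.
  pose n := maxn n1 n2.
  rewrite -[T a f](subrK (s n)) -addrA.
  apply: le_trans (L1T_norm_valD _ _) _.
  rewrite /s -translateX_sum -translateXB val_translateX L1T_norm_translate.
  have := L1T_le (f - \sum_(k < n) u k); have := L1T_le (s n - g).
  have := un n (leq_maxl _ _); have := sn n (leq_maxr _ _).
  rewrite !ltr_pdivlMr// -/(s n) translateX_sum -/(s n); lra.
rewrite Tfg; apply/ler_addgt0Pr => e /sg[n /(_ n (leqnn n))].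
have := is_norm_distD nX (s n) g 0; rewrite !subr0 (is_norm_distC nX g).
have := is_norm_sum nX n (fun k => T a (u k)).
have := uM n; rewrite -/(s n); lra.
Qed.

(** Zabreiko's lemma for [orbit_norm]: countable subadditivity is checked one translation at a time,
    with a bound [M] independent of [a]. *)
Lemma orbit_norm_bounded :
  exists2 C, 0 < C & forall f, orbit_norm f <= C * banach_norm f.
Proof.
have [_ _ OZ OD] := orbit_norm_is_norm.
apply: (countably_subadditive_bounded banach_norm_is_norm
  banach_norm_complete OZ OD).
move=> u f M uf uM; apply: orbit_norm_le => a.
apply: translateX_series_le uf _ => n; apply: le_trans (uM n).
by apply: ler_sum => k _; exact: orbit_norm_ge.
Qed.

End translation_of_subspace.

(** * Equivalence of the two sets of conditions *)

Theorem theorem3p2 (R : realType) (S : submodClosed (L1T R))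
    (X : subBanachType S) (tS : translation_invariant S) :
  (exists N : X -> R,
     [/\ is_norm N,
         equivalent_norms banach_norm N,
         (forall f : X, L1T_norm (val f) <= N f),
         (forall (f : X) (a : R),
            translate a (val f) \in S /\ N (translateX tS a f) = N f) &
         (forall (f : X) (a : R),
            N (translateX tS b f - translateX tS a f) @[b --> a] --> (0 : R))])
  <->
  ((exists2 c : R, 0 < c &
      forall f : X, L1T_norm (val f) <= c * banach_norm f) /\
   (forall f : X,
      banach_norm (translateX tS a f - f) @[a --> (0 : R)] --> (0 : R))).
Proof.
have nX := @banach_norm_is_norm R S X.
split=> [[N [nN [m [M [m0 M0 mM]]] L1N _ TN]]|[[c c0 L1c] T0]].
  split=> [|f].
    by exists M => // f; apply: le_trans (L1N f) (mM f).2.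
  (* Writing [f] as its translate by 0 lets continuity of [N] along the orbit be used at 0. *)
  apply: (@squeeze_cvgr _ _ _ _ (cst 0)
    (fun a => m^-1 * N (translateX tS a f - translateX tS 0 f))).
  - near=> a; rewrite (is_norm_ge0 nX) /= translateX0 mulrC ler_pdivlMr// mulrC.
    exact: (mM _).1.
  - exact: cvg_cst.
  - by rewrite -[Z in _ --> Z](mulr0 m^-1); apply: cvgM (cvg_cst _) (TN f 0).
have [C C0 leC] := orbit_norm_bounded T0 c0 L1c.
have nO := orbit_norm_is_norm T0; have geO := banach_norm_le_orbit T0.
(* The factor [c] turns the L^1 bound with constant [c] into one with constant 1. *)
exists (fun f => c * orbit_norm tS f); split.
- split=> [f|f|k f|f g].
  + by rewrite mulr_ge0 ?(ltW c0)// (is_norm_ge0 nO).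
  + by move=> /eqP; rewrite mulf_eq0 gt_eqF//= => /eqP; exact: (is_norm_eq0 nO).
  + by rewrite (is_normZ nO) mulrCA.
  + by rewrite -mulrDr ler_pM2l// (is_normD nO).
- exists c, (c * C); split=> // [|f]; first exact: mulr_gt0.
  by rewrite -mulrA !ler_pM2l.
- by move=> f; apply: le_trans (L1c f) _; rewrite ler_pM2l.
- move=> f a; split; first exact/tS/valP.
  by rewrite (orbit_norm_translateX T0).
(* The upper equivalence constant [c * C] carries continuity of the orbit from [banach_norm] to the
   new norm. *)
- move=> f a; apply: (@squeeze_cvgr _ _ _ _ (cst 0)
    (fun b => (c * C) * banach_norm (translateX tS b f - translateX tS a f))).
  + near=> b; rewrite mulr_ge0 ?(ltW c0) ?(is_norm_ge0 nO)//=.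
    by rewrite -mulrA ler_pM2l.
  + exact: cvg_cst.
  + rewrite -[Z in _ --> Z](mulr0 (c * C)).
    exact: cvgM (cvg_cst _) (translateX_cvg T0 f a).
Unshelve. all: by end_near. Qed.
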